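(* For each $x\in[0,1]$ and each $\lambda_0\in(\tfrac12,1)$ we have $\phi_\lambda(x)\to\phi_{\lambda_0}(x)$ as $\lambda\to\lambda_0$ (with $\lambda\in(\tfrac12,1)$).
   Context: For $\lambda\in(\tfrac12,1)$, the Bernoulli convolution $\nu_\lambda$ is the Borel probability measure on $[0,1]$ given by the distribution of the random series $(\lambda^{-1}-1)\sum_{i=1}^\infty a_i\lambda^i$, where the digits $a_i$ are chosen independently from $\{0,1\}$, each value with probability $\tfrac12$. Its distribution function is $F_\lambda:[0,1]\to[0,1]$, $F_\lambda(x)=\nu_\lambda[0,x]$. Since $\nu_\lambda$ is non-atomic and fully supported on $[0,1]$, $F_\lambda$ is a strictly increasing continuous bijection of $[0,1]$, with inverse $F_\lambda^{-1}$; moreover $F_\lambda(\tfrac12)=\tfrac12$. The map $\phi_\lambda:[0,1]\to[0,1]$ is defined by $\phi_\lambda(x)=F_\lambda^{-1}(2F_\lambda(x))$ for $x\in[0,\tfrac12]$ and $\phi_\lambda(x)=F_\lambda^{-1}(2F_\lambda(1-x))$ for $x\in[\tfrac12,1]$. *)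

(* Defs.v *)
From HB Require Import structures.
From mathcomp Require Import all_boot all_order all_algebra.
From mathcomp Require Import finmap.
From mathcomp Require Import all_classical all_reals all_analysis.
From mathcomp Require Import measurable_realfun.

Set Implicit Arguments.
Unset Strict Implicit.
Unset Printing Implicit Defensive.

Import Order.TTheory GRing.Theory Num.Theory.
Import numFieldNormedType.Exports.

Local Open Scope classical_set_scope.
Local Open Scope ring_scope.

Definition mutually_independent {d d' : measure_display}
    {Omega : measurableType d} {T : measurableType d'} {R : realType}
    (P : probability Omega R) {I : choiceType} (X : I -> {RV P >-> T}) : Prop :=
  forall (J : {fset I}) (B : I -> set T),
    (forall i, i \in J -> measurable (B i)) ->
    P (\bigcap_(i in [set` J]) (X i @^-1` B i)) =
    (\prod_(i <- J) P (X i @^-1` B i))%E.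

Definition fair_digit {d : measure_display} {Omega : measurableType d}
    {R : realType} (P : probability Omega R) (X : {RV P >-> bool}) : Prop :=
  forall b : bool, P (X @^-1` [set b]) = (2^-1)%:E.

Section bernoulli_convolution.
Context {d : measure_display} {Omega : measurableType d} {R : realType}.
Variables (P : probability Omega R) (a : nat -> {RV P >-> bool}).

(* The digits are numbered from 0: [a i] is the coefficient of [l ^+ i.+1]. *)
Definition bernoulli_series (l : R) (w : Omega) : R :=
  (l^-1 - 1) * limn [series (a i w)%:R * l ^+ i.+1]_i.

Lemma measurable_bernoulli_series (l : R) : l \in `]2^-1, 1[ ->
  measurable_fun [set: Omega] (bernoulli_series l).
Proof.
rewrite in_itv/= => /andP[l2 l1].
have l0 : 0 < l by rewrite (lt_trans _ l2)// invr_gt0.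
apply: measurable_funM; first exact: measurable_cst.
apply: (@measurable_fun_cvg _ _ _ _
  (fun n w => \sum_(0 <= i < n) (a i w)%:R * l ^+ i.+1)).
  move=> n; apply: measurable_sum => i.
  apply: measurable_funM; last exact: measurable_cst.
  exact: (@measurableT_comp _ _ _ _ _ _ (fun b : bool => (b%:R : R))).
move=> w _.
apply: (@series_le_cvg _ _ (geometric 1 l)).
- by move=> n; rewrite mulr_ge0// exprn_ge0// ltW.
- by move=> n; rewrite /= mul1r exprn_ge0// ltW.
- move=> n; rewrite /= mul1r exprS mulrA ler_piMl ?exprn_ge0 ?(ltW l0)//.
  by case: (a n w); rewrite ?mul1r ?mul0r// ltW.
- by apply: is_cvg_geometric_series; rewrite gtr0_norm.
Qed.

(* The law of the series, a Borel measure on R concentrated on [0, 1]. The bare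
   [pushforward] is used rather than [distribution], which asks for a series
   that is measurable for every [l]. *)
Definition bernoulli_conv (l : R) : set R -> \bar R :=
  pushforward P (bernoulli_series l).

Definition bernoulli_cdf (l x : R) : R := fine (bernoulli_conv l `[0, x]).

(* Inverse of the bijection [bernoulli_cdf l] of [0, 1]; 0 is a junk value
   outside the image of [0, 1]. *)
Definition bernoulli_cdf_inv (l : R) : R -> R :=
  'pinv_(fun=> 0) `[0, 1] (bernoulli_cdf l).

Definition bernoulli_phi (l x : R) : R :=
  if x <= 2^-1 then bernoulli_cdf_inv l (2 * bernoulli_cdf l x)
  else bernoulli_cdf_inv l (2 * bernoulli_cdf l (1 - x)).

End bernoulli_convolution.

(* Main.v *)
Require Import Defs.
From mathcomp Require Import all_boot all_order all_algebra.
From mathcomp Require Import finmap.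
From mathcomp Require Import all_classical all_reals all_analysis.
From mathcomp Require Import ring lra.
Import Order.TTheory GRing.Theory Num.Theory.
Import numFieldNormedType.Exports.
Local Open Scope classical_set_scope.
Local Open Scope ring_scope.

(** Write [X l] for the random series of ratio [l] and [F l] for its
distribution function. Everything is read off finite prefixes of the digit
sequence: the sum [word_sum] of the first [n] digits determines the series up to
[l ^+ n] (lemma [digit_sum_bounds]), and by independence the first [n] digits
are uniformly distributed over the [2 ^ n] words (lemma [prob_word_event]).
Questions about the law thus become counting problems on words.

The key estimate is that small balls have uniformly small mass (lemma
[small_ball]). Take the set [A] of words of length [N] whose sum falls in a
tiny interval. Flipping one of the first [M] digits moves the sum by
[(1 - l) * l ^+ i] up or down, and these displacements are pairwise well
separated; so the [M] flipped copies of [A] are disjoint and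
[M * #|A| <= 2 ^ N], that is, the interval has mass at most [1 / M]. Besides
the continuity of [F l], this gives [F l x --> F l0 x] as [l --> l0], because
[X l] tends to [X l0] uniformly on the probability space (lemma
[digit_sum_near]), so that [F l x] and [F l0 x] differ by at most the mass of a
small ball about [x] (lemma [bernoulli_cdf_dist_le]).

The function [F l] is strictly increasing on [0, 1], since greedy expansions,
available as [l > 1/2], provide a cylinder inside every subinterval. Negating
all digits shows [F l (1/2) <= 1/2], so [2 * F l x] stays in [0, 1] for
[x <= 1/2] and is in the range of [F l]. Finally, pointwise convergence of the
monotone functions [F l] to a strictly increasing limit passes to the inverses,
even when the argument varies with [l] (lemma [bernoulli_cdf_inv_cvg]); applied
to [2 * F l x], or to [2 * F l (1 - x)] when [x > 1/2], this is the claim. *)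

(** * Digit sequences and their finite prefixes *)

(** The normalising factor of the series is distributed over its terms, as
[(l^-1 - 1) * l ^+ i.+1 = (1 - l) * l ^+ i]. *)
Definition word_sum {R : realType} (l : R) {n : nat} (u :
  {ffun 'I_n -> bool}) : R :=
  (1 - l) * \sum_(i < n) (u i)%:R * l ^+ i.

Definition digit_sum {R : realType} (l : R) (s : nat -> bool) : R :=
  (l^-1 - 1) * limn [series (s i)%:R * l ^+ i.+1]_i.

Definition prefix_word (n : nat) (s : nat -> bool) : {ffun 'I_n -> bool} :=
  [ffun i : 'I_n => s i].

Lemma word_sum0 {R : realType} (l : R) (s : nat -> bool) :
  word_sum l (prefix_word 0 s) = 0.
Proof. by rewrite /word_sum big_ord0 mulr0. Qed.

Lemma word_sumS {R : realType} (l : R) (n : nat) (s : nat -> bool) :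
  word_sum l (prefix_word n.+1 s) =
  word_sum l (prefix_word n s) + (s n)%:R * ((1 - l) * l ^+ n).
Proof.
rewrite /word_sum big_ord_recr/= mulrDr ffunE; congr (_ * _ + _).
  by apply: eq_bigr => i _; rewrite !ffunE.
by rewrite mulrCA.
Qed.

Lemma word_sum_homo {R : realType} (l : R) (s : nat -> bool) :
  0 <= l <= 1 ->
  {homo (fun n => word_sum l (prefix_word n s)) : m n / (m <= n)%N >-> m <= n}.
Proof.
move=> /andP[l0 l1]; apply: homo_leq => // [|n]; first exact: le_trans.
by rewrite word_sumS lerDl !mulr_ge0// ?subr_ge0// exprn_ge0.
Qed.

(** After [n] digits the tail of the series is at most [l ^+ n], the value it
takes when all the remaining digits are 1; each further digit narrows this
bound. *)
Lemma word_sum_upper_homo {R : realType} (l : R) (s : nat -> bool) :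
  0 <= l <= 1 ->
  {homo (fun n => word_sum l (prefix_word n s) + l ^+ n) :
     m n / (m <= n)%N >-> n <= m}.
Proof.
move=> /andP[l0 l1].
apply: (@homo_leq _ _ (fun x y => y <= x)) => // [x y z xy yz|n].
  exact: le_trans yz xy.
rewrite word_sumS exprS -addrA lerD2l.
have : 0 <= l ^+ n by rewrite exprn_ge0.
by case: (s n); rewrite ?mul1r ?mul0r; nra.
Qed.

Lemma cvg_digit_sum {R : realType} (l : R) (s : nat -> bool) : 0 < l < 1 ->
  word_sum l (prefix_word n s) @[n --> \oo] --> digit_sum l s.
Proof.
move=> /andP[l0 l1].
have cs : cvgn [series (s i)%:R * l ^+ i.+1]_i.
  apply: (@series_le_cvg _ _ (geometric 1 l)).
  - by move=> n; rewrite mulr_ge0// exprn_ge0// ltW.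
  - by move=> n; rewrite /= mul1r exprn_ge0// ltW.
  - move=> n; rewrite /= mul1r exprS mulrA ler_piMl ?exprn_ge0 ?(ltW l0)//.
    by case: (s n); rewrite ?mul1r ?mul0r// ltW.
  - by apply: is_cvg_geometric_series; rewrite gtr0_norm.
have : (l^-1 - 1) * [series (s i)%:R * l ^+ i.+1]_i n @[n --> \oo] -->
    digit_sum l s by apply: cvgM; [exact: cvg_cst|exact: cs].
apply: cvg_trans; apply: near_eq_cvg; near=> n.
rewrite /= /series /word_sum/= big_mkord !mulr_sumr; apply: eq_bigr => i _.
by rewrite ffunE exprS; field; rewrite gt_eqF.
Unshelve. all: by end_near. Qed.

Lemma digit_sum_bounds {R : realType} (l : R) (s : nat -> bool) (n : nat) :
  0 < l < 1 ->
  word_sum l (prefix_word n s) <= digit_sum l s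
    <= word_sum l (prefix_word n s) + l ^+ n.
Proof.
move=> l01; have l01' : 0 <= l <= 1 by case/andP: l01 => /ltW-> /ltW->.
have c := cvg_digit_sum l s l01.
rewrite -(cvg_lim _ c)//; apply/andP; split.
  by apply: (nondecreasing_cvgn_le (word_sum_homo l s l01')); exact: cvgP c.
apply: limr_le; first exact: cvgP c.
near=> m; have nm : (n <= m)%N by near: m; exact: nbhs_infty_ge.
apply: le_trans (word_sum_upper_homo l s l01' _ _ nm).
by rewrite lerDl exprn_ge0//; case/andP: l01'.
Unshelve. all: by end_near. Qed.

Lemma digit_sum_in01 {R : realType} (l : R) (s : nat -> bool) :
  0 < l < 1 -> 0 <= digit_sum l s <= 1.
Proof.
move=> l01; have := digit_sum_bounds l s 0 l01.
by rewrite word_sum0 add0r expr0.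
Qed.

(** A greedy digit choice: as [l >= 1/2], the intervals [0, l] and [1 - l, 1]
cover [0, 1], hence every point of [0, 1] has an expansion. *)
Lemma word_sum_approx {R : realType} (l z : R) (n : nat) :
  2^-1 <= l < 1 -> 0 <= z <= 1 ->
  exists s : nat -> bool,
    word_sum l (prefix_word n s) <= z <= word_sum l (prefix_word n s) + l ^+ n.
Proof.
move=> /andP[l2 l1] z01; elim: n => [|n [s hs]].
  by exists (fun=> false); rewrite word_sum0 add0r expr0.
have ln0 : 0 <= l ^+ n by rewrite exprn_ge0//; lra.
set w := word_sum l (prefix_word n s) in hs *; set p := l ^+ n in hs ln0 *.
have /andP[hs1 hs2] := hs.
suff [b hb] : exists b : bool, w + b%:R * ((1 - l) * p) <= z
    <= w + b%:R * ((1 - l) * p) + l * p.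
  exists (fun i => if i == n then b else s i).
  rewrite word_sumS eqxx exprS.
  have -> // : prefix_word n (fun i => if i == n then b else s i) =
    prefix_word n s by apply/ffunP => i; rewrite !ffunE ltn_eqF.
have [hz|hz] := leP (w + (1 - l) * p) z.
  by exists true; rewrite mul1r hz/=; nra.
by exists false; rewrite mul0r addr0 hs1/=; nra.
Qed.

Lemma expr_lt_small {R : realType} (l e : R) : 0 < l < 1 -> 0 < e ->
  exists n, l ^+ n < e.
Proof.
move=> /andP[l0 l1] e0.
have /cvgrPdist_lt/(_ e e0)[n _ /(_ n (leqnn n))] :
  l ^+ n @[n --> \oo] --> (0 : R).
  by apply: cvg_expr; rewrite gtr0_norm.
by rewrite /= sub0r normrN gtr0_norm ?exprn_gt0//; exists n.
Qed.

Lemma ratio_bounds {R : realType} (l : R) :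
  l \in `]2^-1, 1[ -> 2^-1 < l /\ 0 < l < 1.
Proof. by rewrite in_itv/= => /andP[l2 l1]; split => //; lra. Qed.

(** On a compact range of ratios the tails are uniformly small, and the finite
sums are polynomials in the ratio. *)
Lemma digit_sum_near {R : realType} (l0 e : R) : l0 \in `]2^-1, 1[ -> 0 < e ->
  \forall l \near within `]2^-1, 1[ (nbhs l0),
    forall s, `|digit_sum l s - digit_sum l0 s| <= e.
Proof.
move=> hl0 e0; have [l02 l001] := ratio_bounds l0 hl0.
have /andP[l00 l01] := l001.
pose c := (l0 + 1) / 2.
have [c0 c1 l0c] : [/\ 0 < c, c < 1 & l0 < c] by rewrite /c; split; lra.
have c01 : 0 < c < 1 by rewrite c0.
have e3 : 0 < e / 3 by lra.
have [n cn] := expr_lt_small c (e / 3) c01 e3.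
have finite_near m e' : 0 < e' -> \forall l \near nbhs l0,
    forall s, `|word_sum l (prefix_word m s)
      - word_sum l0 (prefix_word m s)| <= e'.
  elim: m e' => [|m IH] e' e'0.
    by near=> l => s; rewrite !word_sum0 subrr normr0 ltW.
  have e'2 : 0 < e' / 2 by lra.
  have cvgm : (1 - l) * l ^+ m @[l --> l0] --> (1 - l0) * l0 ^+ m.
    apply: cvgM; last exact: exprn_continuous.
    by apply: cvgB; [exact: cvg_cst|exact: cvg_id].
  near=> l => s; rewrite !word_sumS.
  have h1 : `|word_sum l (prefix_word m s) - word_sum l0 (prefix_word m s)| <=
    e' / 2.
    by move: s; near: l; exact: IH.
  have h2 : `|(1 - l0) * l0 ^+ m - (1 - l) * l ^+ m| <= e' / 2.
    by near: l; move/cvgrPdist_le : cvgm; exact.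
  move: h1 h2; rewrite !ler_norml => /andP[? ?] /andP[? ?].
  by case: (s m); rewrite ?mul1r ?mul0r; apply/andP; split; lra.
near=> l => s.
have /ratio_bounds[_ l01'] : l \in `]2^-1, 1[ by near: l; exact: withinT.
have lc : l <= c.
  near: l; apply: cvg_within; near=> l; apply: ltW.
  by near: l; exact: lt_nbhsl.
have h : `|word_sum l (prefix_word n s) - word_sum l0 (prefix_word n s)| <=
  e / 3.
  by move: s; near: l; apply: cvg_within; exact: finite_near.
have /andP[h1 h2] := digit_sum_bounds l s n l01'.
have /andP[h3 h4] := digit_sum_bounds l0 s n l001.
have h5 : l ^+ n <= c ^+ n.
  by rewrite lerXn2r ?nnegrE ?(ltW c0)//; case/andP: l01' => /ltW.
have h6 : l0 ^+ n <= c ^+ n.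
  by rewrite lerXn2r ?nnegrE ?(ltW c0) ?(ltW l00) ?(ltW l0c).
by move: h; rewrite !ler_norml => /andP[? ?]; apply/andP; split; lra.
Unshelve. all: by end_near. Qed.

(** * The distribution of prefixes *)

Lemma prefix_word_surj (n : nat) (u : {ffun 'I_n -> bool}) :
  exists s, prefix_word n s = u.
Proof.
exists (fun i => if insub i is Some j then u j else false).
by apply/ffunP => i; rewrite ffunE valK.
Qed.

Lemma prefix_wordP (n : nat) (s t : nat -> bool) :
  prefix_word n s = prefix_word n t <-> forall i, (i < n)%N -> s i = t i.
Proof.
split=> [/ffunP st i ni|st]; last by apply/ffunP => i; rewrite !ffunE st.
by have := st (Ordinal ni); rewrite !ffunE.
Qed.

Section words.
Context {R : realType} {d : measure_display} {Omega : measurableType d}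
  {P : probability Omega R} (a : nat -> {RV P >-> bool}).

Lemma cylinderE (n : nat) (s : nat -> bool) :
  [set w | prefix_word n (a^~ w) = prefix_word n s] =
  \bigcap_(i in [set` [fset i in iota 0 n]%fset]) (a i @^-1` [set s i]).
Proof.
apply/seteqP; split=> [w /= /prefix_wordP h i/=|w h].
  by rewrite !inE mem_iota add0n; exact: h.
apply/prefix_wordP => i ni; apply: h => /=.
by rewrite !inE mem_iota add0n.
Qed.

Lemma measurable_digit (i : nat) (b : bool) : measurable (a i @^-1` [set b]).
Proof. by rewrite -[X in measurable X]setTI; exact: measurable_funPT. Qed.

Lemma measurable_cylinder (n : nat) (u : {ffun 'I_n -> bool}) :
  measurable [set w | prefix_word n (a^~ w) = u].
Proof.
have [s <-] := prefix_word_surj n u; rewrite cylinderE.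
by apply: fin_bigcap_measurable => // i _; exact: measurable_digit.
Qed.

Lemma word_eventE (n : nat) (A : {set {ffun 'I_n -> bool}}) :
  [set w | prefix_word n (a^~ w) \in A] =
  \bigcup_(u in [set` enum A]) [set w | prefix_word n (a^~ w) = u].
Proof.
apply/seteqP; split=> [w/= h|w [u /=]]; last by rewrite mem_enum => + ->.
by exists (prefix_word n (a^~ w)) => //=; rewrite mem_enum.
Qed.

Lemma measurable_word_event (n : nat) (A : {set {ffun 'I_n -> bool}}) :
  measurable [set w | prefix_word n (a^~ w) \in A].
Proof.
rewrite word_eventE; apply: fin_bigcup_measurable => // u _.
exact: measurable_cylinder.
Qed.

Hypothesis a_indep : mutually_independent a.
Hypothesis a_fair : forall i, fair_digit (a i).

Lemma prob_cylinder (n : nat) (u : {ffun 'I_n -> bool}) :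
  P [set w | prefix_word n (a^~ w) = u] = (2^-1 ^+ n)%:E.
Proof.
have [s <-] := prefix_word_surj n u; rewrite cylinderE a_indep//.
under eq_bigr do rewrite a_fair.
rewrite prodEFin big_const_seq count_predT -[size _]/(#|` _|).
by rewrite card_fseq undup_id ?iota_uniq// size_iota iter_mulr_1.
Qed.

(** Turns estimates on the law of the series into counts of words: independence
and fairness make all the words of length [n] equally likely. *)
Lemma prob_word_event (n : nat) (A : {set {ffun 'I_n -> bool}}) :
  P [set w | prefix_word n (a^~ w) \in A] = (#|A|%:R / 2 ^+ n)%:E.
Proof.
rewrite word_eventE measure_fin_bigcup//.
- rewrite (eq_fsbigr (fun=> (2^-1 ^+ n)%:E)); last first.
    by move=> u _; exact: prob_cylinder.
  rewrite -(@fsbig_seq _ _ _ _ _ (fun=> _)) ?enum_uniq//.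
  rewrite sumEFin big_const_seq count_predT -cardE iter_addr_0.
  by rewrite -[X in X%:E]mulr_natl exprVn.
- by move=> u v _ _ [w [/= <- <-]].
- by move=> u _; exact: measurable_cylinder.
Qed.

End words.

(** * Flipping digits *)

Definition flip_digit {n : nat} (i : 'I_n) (u : {ffun 'I_n -> bool}) :
  {ffun 'I_n -> bool} := [ffun j => (j == i) (+) u j].

Lemma flip_digitK {n : nat} (i : 'I_n) : involutive (flip_digit i).
Proof. by move=> u; apply/ffunP => j; rewrite !ffunE addbA addbb. Qed.

Lemma word_sum_flip {R : realType} (l : R) {n : nat} (i : 'I_n)
    (u : {ffun 'I_n -> bool}) :
  word_sum l (flip_digit i u) = word_sum l u + (-1) ^+ u i * ((1 - l) * l ^+ i).
Proof.
rewrite /word_sum (bigD1 i)//= [in RHS](bigD1 i)//= !ffunE eqxx.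
rewrite (eq_bigr (fun j : 'I_n => (u j)%:R * l ^+ j)); last first.
  by move=> j /negbTE ji; rewrite !ffunE ji.
by case: (u i) => /=; ring.
Qed.

(** If two words have close sums, flipping digit [i] in the first and another
digit [j] in the second moves the sums by different amounts, so the results
differ. Hence the [M] images of [A] under the flips of the first [M] digits are
pairwise disjoint. *)
Lemma card_close_words {R : realType} (l : R) (M N : nat)
    (A : {set {ffun 'I_N -> bool}}) :
  0 < l < 1 -> (M <= N)%N ->
  {in A &, forall u v,
    `|word_sum l u - word_sum l v| < (1 - l) ^+ 2 * l ^+ M} ->
  (M * #|A| <= 2 ^ N)%N.
Proof.
move=> /andP[l0 l1] MN close.
pose f (z : 'I_M * {ffun 'I_N -> bool}) := flip_digit (widen_ord MN z.1) z.2.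
have flip_neq (i j : 'I_M) u v : u \in A -> v \in A -> (i < j)%N ->
    flip_digit (widen_ord MN i) u <> flip_digit (widen_ord MN j) v.
  move=> uA vA ij /(congr1 (word_sum l)); rewrite !word_sum_flip/= => e.
  have := close _ _ uA vA.
  have li : l ^+ M <= l ^+ i.
    by rewrite ler_wiXn2l ?(ltW l0) ?(ltW l1) ?(ltnW (ltn_ord i)).
  have lj : l ^+ j <= l * l ^+ i.
    by rewrite -exprS ler_wiXn2l ?(ltW l0) ?(ltW l1).
  have lj0 : 0 <= (1 - l) * l ^+ j by rewrite mulr_ge0 ?exprn_ge0//; lra.
  (* as [i < j], the move by flip [i] exceeds the one by flip [j], whatever
     their signs, by at least the assumed bound on the distance of the sums *)
  have gap : (1 - l) ^+ 2 * l ^+ M <= (1 - l) * l ^+ i - (1 - l) * l ^+ j.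
    by rewrite expr2 -mulrA -mulrBr ler_pM2l; nra.
  rewrite ltr_norml => /andP[h1 h2].
  by case: (u _) e; case: (v _); rewrite ?expr0 ?expr1 => e; lra.
have inj : {in finset.setX [set: 'I_M]%SET A &, injective f}.
  move=> [i u] [j v]; rewrite !inE/= => uA vA; rewrite /f/=.
  have [ij|ij|/val_inj <-] := ltngtP i j.
  - by move/flip_neq; case/(_ uA vA ij).
  - by move/esym/flip_neq; case/(_ vA uA ij).
  - by move/(can_inj (flip_digitK _)) => ->.
have := max_card (mem (f @: finset.setX [set: 'I_M]%SET A)).
by rewrite card_in_imset// cardsX cardsT card_ord card_ffun card_bool card_ord.
Qed.

Lemma word_sum_neg {R : realType} (l : R) {n : nat} (u : {ffun 'I_n -> bool}) :
  word_sum l [ffun i => ~~ u i] = 1 - l ^+ n - word_sum l u.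
Proof.
apply/eqP; rewrite eq_sym subr_eq -mulrDr -big_split/=
  -opprB subrX1 -mulNr opprB.
apply/eqP; congr (_ * _); apply: eq_bigr => i _; rewrite ffunE.
by case: (u i); rewrite /= ?mul1r ?mul0r ?addr0 ?add0r.
Qed.

(** * Absence of atoms *)

Section law.
Context {R : realType} {d : measure_display} {Omega : measurableType d}
  {P : probability Omega R} (a : nat -> {RV P >-> bool}).
Local Notation X := (bernoulli_series a).
Local Notation prob A := (fine (P A)).

Lemma prob_le (A B : set Omega) :
  measurable A -> measurable B -> A `<=` B -> prob A <= prob B.
Proof.
move=> mA mB AB; rewrite fine_le ?fin_num_measure//.
by rewrite le_measure ?inE.
Qed.

Lemma prob_dist_le (A B C : set Omega) :
  measurable A -> measurable B -> measurable C ->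
  A `<=` B `|` C -> B `<=` A `|` C -> `|prob A - prob B| <= prob C.
Proof.
have le A' B' : measurable A' -> measurable B' -> measurable C ->
    A' `<=` B' `|` C -> prob A' <= prob B' + prob C.
  move=> mA mB mC ABC; rewrite -fineD ?fin_num_measure//.
  rewrite fine_le ?fin_numD ?fin_num_measure//.
  apply: le_trans (measureU2 P mB mC); apply: le_measure => //; rewrite inE//.
  exact: measurableU.
move=> mA mB mC AB BA; rewrite ler_norml.
have := le _ _ mA mB mC AB; have := le _ _ mB mA mC BA.
by lra.
Qed.

Lemma bernoulli_seriesE (l : R) (w : Omega) : X l w = digit_sum l (a^~ w).
Proof. by []. Qed.

Lemma measurable_series_preimage (l : R) (B : set R) :
  l \in `]2^-1, 1[ -> measurable B -> measurable (X l @^-1` B).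
Proof.
move=> hl mB; rewrite -[X in measurable X]setTI.
exact: measurable_bernoulli_series.
Qed.

(** The series is nonnegative, so the lower bound of [`[0, y]] can be dropped;
this also covers the points [y] outside [0, 1]. *)
Lemma bernoulli_cdfE (l y : R) : l \in `]2^-1, 1[ ->
  bernoulli_cdf a l y = prob (X l @^-1` `]-oo, y]).
Proof.
move=> /ratio_bounds[_ l01]; congr (fine (P _)).
apply/seteqP; split=> w /=; rewrite !in_itv/=; first by case/andP.
move=> ->; rewrite andbT.
by have /andP[->] := digit_sum_in01 l (a^~ w) l01.
Qed.

Hypothesis a_indep : mutually_independent a.
Hypothesis a_fair : forall i, fair_digit (a i).

(** If the series lies in the ball, the sum of its first [M.+1 + k] terms is in
an interval of length [4 * l ^+ (M.+1 + k)], which for large [k] is short enough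
for [card_close_words]. *)
Lemma small_ball (l e : R) : l \in `]2^-1, 1[ -> 0 < e ->
  exists2 r, 0 < r & forall x, prob (X l @^-1` `[x - r, x + r]) <= e.
Proof.
move=> hl e0; have [l2 l01] := ratio_bounds l hl; have /andP[l0 l1] := l01.
have [M] : exists M, (M.+1%:R : R)^-1 < e.
  exists (Num.truncn e^-1); rewrite invf_plt ?posrE//.
  exact: truncnS_gt.
move=> Me.
have [k lk] := expr_lt_small l ((1 - l) ^+ 2 / 4) l01
  ltac:(rewrite divr_gt0// exprn_gt0// subr_gt0//).
pose N := (M.+1 + k)%N.
have lN0 : 0 < l ^+ N by rewrite exprn_gt0.
exists (l ^+ N) => // x.
pose A := [set u : {ffun 'I_N -> bool} | `|word_sum l u - x| <= 2 * l ^+ N]%SET.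
have cardA : (M.+1 * #|A| <= 2 ^ N)%N.
  apply: (card_close_words l) => //; first exact: leq_addr.
  move=> u v; rewrite !inE !ler_norml => /andP[u1 u2] /andP[v1 v2].
  apply: (@le_lt_trans _ _ (4 * l ^+ N)); first by rewrite ler_norml; lra.
  by rewrite /N exprD mulrCA mulrC ltr_pM2r ?exprn_gt0//; lra.
apply: le_trans (ltW Me).
apply: (@le_trans _ _ (prob [set w | prefix_word N (a^~ w) \in A])).
  apply: prob_le.
  - exact: measurable_series_preimage.
  - exact: measurable_word_event.
  - move=> w /=; rewrite in_itv/= !inE ler_norml bernoulli_seriesE.
    move=> /andP[h1 h2].
    have /andP[h3 h4] := digit_sum_bounds l (a^~ w) N l01.
    by apply/andP; split; lra.
rewrite prob_word_event//= ler_pdivrMr ?exprn_gt0// mulrC ler_pdivlMr//.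
by rewrite -natrM -natrX ler_nat mulnC.
Qed.

(** The events [X l <= y] and [X l' <= y'] can differ only where [X l] lies
within [r] of [y]. Taking [l = l'] gives continuity in the point, and [y = y']
continuity in the ratio. *)
Lemma bernoulli_cdf_dist_le (l l' y y' r : R) :
  l \in `]2^-1, 1[ -> l' \in `]2^-1, 1[ ->
  (forall w, `|X l w - X l' w| + `|y - y'| <= r) ->
  `|bernoulli_cdf a l y - bernoulli_cdf a l' y'| <=
    prob (X l @^-1` `[y - r, y + r]).
Proof.
move=> hl hl' h; rewrite !bernoulli_cdfE//.
apply: prob_dist_le; try exact: measurable_series_preimage.
- move=> w /=; have := h w; rewrite !in_itv/=.
  have := ler_norm (X l w - X l' w); have := ler_norm (X l' w - X l w).
  have := ler_norm (y - y'); have := ler_norm (y' - y).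
  rewrite (distrC (X l' w)) (distrC y').
  have [|h1] := leP (X l' w) y'; first by left.
  by right; apply/andP; split; lra.
- move=> w /=; have := h w; rewrite !in_itv/=.
  have := ler_norm (X l w - X l' w); have := ler_norm (X l' w - X l w).
  have := ler_norm (y - y'); have := ler_norm (y' - y).
  rewrite (distrC (X l' w)) (distrC y').
  have [|h1] := leP (X l w) y; first by left.
  by right; apply/andP; split; lra.
Qed.
End law.

(** * The distribution function *)

Section cdf.
Context {R : realType} {d : measure_display} {Omega : measurableType d}
  {P : probability Omega R} (a : nat -> {RV P >-> bool}).
Local Notation X := (bernoulli_series a).
Local Notation F := (bernoulli_cdf a).
Local Notation prob A := (fine (P A)).

Lemma bernoulli_cdf_homo (l : R) :
  l \in `]2^-1, 1[ -> {homo F l : x y / x <= y}.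
Proof.
move=> hl x y xy; rewrite !bernoulli_cdfE//.
apply: prob_le; try exact: measurable_series_preimage.
by move=> w /=; rewrite !in_itv/= => /le_trans; exact.
Qed.

Lemma bernoulli_cdf_ge0 (l x : R) : 0 <= F l x.
Proof. by apply: fine_ge0; exact: (measure_ge0 P). Qed.

Lemma bernoulli_cdf1 (l : R) : l \in `]2^-1, 1[ -> F l 1 = 1.
Proof.
move=> hl; rewrite bernoulli_cdfE// (_ : _ @^-1` _ = setT).
  by rewrite probability_setT.
apply/seteqP; split=> // w _ /=; rewrite in_itv/= bernoulli_seriesE.
by have /andP[] := digit_sum_in01 l (a^~ w) (ratio_bounds l hl).2.
Qed.

Hypothesis a_indep : mutually_independent a.
Hypothesis a_fair : forall i, fair_digit (a i).

Lemma bernoulli_cdf0 (l : R) : l \in `]2^-1, 1[ -> F l 0 = 0.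
Proof.
move=> hl; apply/le_anti; rewrite bernoulli_cdf_ge0 andbT.
apply/ler_addgt0Pl => e e0.
have [r r0 small] := small_ball a a_indep a_fair l e hl e0.
rewrite addr0; apply: le_trans (small 0); rewrite bernoulli_cdfE//.
apply: prob_le; try exact: measurable_series_preimage.
move=> w /=; rewrite !in_itv/= => h.
have /andP[h0 _] := digit_sum_in01 l (a^~ w) (ratio_bounds l hl).2.
by rewrite bernoulli_seriesE in h *; apply/andP; split; lra.
Qed.

Lemma bernoulli_cdf_continuous (l : R) : l \in `]2^-1, 1[ -> continuous (F l).
Proof.
move=> hl y; apply/cvgrPdist_le => e e0.
have [r r0 small] := small_ball a a_indep a_fair l e hl e0.
near=> z; apply: le_trans (small y); apply: bernoulli_cdf_dist_le => // w.
rewrite subrr normr0 add0r; near: z.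
by apply: (@cvgr_dist_le _ _ _ _ _ id y) => //; exact: cvg_id.
Unshelve. all: by end_near. Qed.

Lemma bernoulli_cdf_cvg_ratio (l0 y : R) : l0 \in `]2^-1, 1[ ->
  F l y @[l --> within `]2^-1, 1[ (nbhs l0)] --> F l0 y.
Proof.
move=> hl0; apply/cvgrPdist_le => e e0.
have [r r0 small] := small_ball a a_indep a_fair l0 e hl0 e0.
near=> l; apply: le_trans (small y); apply: bernoulli_cdf_dist_le => //.
  by near: l; exact: withinT.
move=> w; rewrite (subrr y) normr0 addr0 !bernoulli_seriesE distrC.
by move: (a^~ w); near: l; exact: digit_sum_near.
Unshelve. all: by end_near. Qed.

(** Full support: the greedy expansion of the midpoint of [x] and [y] gives a
cylinder on which the series stays between [x] and [y]. *)
Lemma bernoulli_cdf_lt (l x y : R) : l \in `]2^-1, 1[ ->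
  0 <= x -> x < y -> y <= 1 -> F l x < F l y.
Proof.
move=> hl x0 xy y1; have [l2 l01] := ratio_bounds l hl.
have [n ln] := expr_lt_small l ((y - x) / 2) l01 ltac:(lra).
have [||s /andP[s1 s2]] := word_sum_approx l ((x + y) / 2) n; [lra|lra|].
pose C := [set w | prefix_word n (a^~ w) = prefix_word n s].
have PC : P C = (2^-1 ^+ n)%:E by exact: prob_cylinder.
have mC : measurable C by exact: measurable_cylinder.
apply: (@lt_le_trans _ _ (F l x + prob C)).
  by rewrite ltrDl PC/= exprn_gt0// invr_gt0.
have bounds w : C w -> x < X l w <= y.
  move=> /= Cw; have := digit_sum_bounds l (a^~ w) n l01.
  by rewrite Cw bernoulli_seriesE => /andP[h1 h2]; apply/andP; split; lra.
have mx : measurable (X l @^-1` `]-oo, x]) by exact: measurable_series_preimage.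
rewrite !bernoulli_cdfE// -fineD ?fin_num_measure// -measureU//; last first.
  rewrite -subset0 => w [/= + Cw]; rewrite in_itv/=.
  by case/andP: (bounds w Cw) => /lt_geF->.
apply: prob_le; [exact: measurableU|exact: measurable_series_preimage|].
move=> w /=; rewrite !in_itv/= => -[h|/bounds/andP[]//].
exact: le_trans h (ltW xy).
Qed.

(** Negating all the digits turns a word of sum [x] into one of sum
[1 - l ^+ n - x], so the law is symmetric about [1/2]; with the absence of
atoms, each half of [0, 1] has mass [1/2]. *)
Lemma bernoulli_cdf_half (l : R) : l \in `]2^-1, 1[ -> F l 2^-1 <= 2^-1.
Proof.
move=> hl; have [l2 l01] := ratio_bounds l hl.
suff h e : 0 < e -> 2 * F l 2^-1 <= 1 + e.
  have /ler_addgt0Pr : forall e, 0 < e -> 2 * F l 2^-1 <= 1 + e by exact: h.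
  by lra.
move=> e0; have [r r0 small] := small_ball a a_indep a_fair l e hl e0.
have [n ln] := expr_lt_small l r l01 r0.
(* negating [n] digits reflects the sum about [(1 - l ^+ n) / 2] rather than
   [1/2]; the margin [r > l ^+ n] makes up for the difference *)
pose A := [set u : {ffun 'I_n -> bool} | word_sum l u <= 2^-1]%SET.
pose B := [set u : {ffun 'I_n -> bool} | 2^-1 - r <= word_sum l u]%SET.
have AB : (#|A| <= #|B|)%N.
  pose neg (u : {ffun 'I_n -> bool}) := [ffun i => ~~ u i].
  have negK : involutive neg.
    by move=> u; apply/ffunP => i; rewrite !ffunE negbK.
  rewrite -(card_imset A (can_inj negK)); apply: subset_leq_card.
  apply/fintype.subsetP => _ /imsetP[u + ->]; rewrite !inE word_sum_neg; lra.
have mle : measurable (X l @^-1` `]-oo, 2^-1]).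
  exact: measurable_series_preimage.
have mge : measurable (X l @^-1` `[2^-1 - r, +oo[).
  exact: measurable_series_preimage.
have mball : measurable (X l @^-1` `[2^-1 - r, 2^-1 + r]).
  exact: measurable_series_preimage.
have le_ge : F l 2^-1 <= prob (X l @^-1` `[2^-1 - r, +oo[).
  rewrite bernoulli_cdfE//.
  apply: (@le_trans _ _ (prob [set w | prefix_word n (a^~ w) \in A])).
    apply: prob_le => //; first exact: measurable_word_event.
    move=> w /=; rewrite in_itv/= !inE bernoulli_seriesE => h.
    by have /andP[+ _] := digit_sum_bounds l (a^~ w) n l01; lra.
  apply: (@le_trans _ _ (prob [set w | prefix_word n (a^~ w) \in B])).
    by rewrite !prob_word_event//= ler_pM2r ?invr_gt0 ?exprn_gt0// ler_nat.
  apply: prob_le => //; first exact: measurable_word_event.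
  move=> w /=; rewrite in_itv/= !inE bernoulli_seriesE => h.
  by have /andP[+ _] := digit_sum_bounds l (a^~ w) n l01; lra.
have ge_le : prob (X l @^-1` `[2^-1 - r, +oo[) <= 1 - F l 2^-1 + e.
  apply: (@le_trans _ _
    (1 - F l 2^-1 + prob (X l @^-1` `[2^-1 - r, 2^-1 + r]))).
    rewrite bernoulli_cdfE//.
    have -> : 1 - prob (X l @^-1` `]-oo, 2^-1]) =
        prob (~` (X l @^-1` `]-oo, 2^-1])).
      by rewrite probability_setC// fineB ?fin_num_measure.
    have mgt := measurableC mle.
    rewrite -fineD ?fin_num_measure// fine_le ?fin_numD ?fin_num_measure//.
    apply: le_trans (measureU2 P mgt mball).
    apply: le_measure; rewrite ?inE//; first exact: measurableU.
    move=> w /=; rewrite !in_itv/= andbT => h.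
    have [h'|h'] := leP (X l w) 2^-1; first by right; rewrite h/=; lra.
    by left.
  by rewrite lerD2l small.
by lra.
Qed.
End cdf.

(** * Convergence of the inverses *)

Section inverse.
Context {R : realType} {d : measure_display} {Omega : measurableType d}
  {P : probability Omega R} (a : nat -> {RV P >-> bool}).
Local Notation F := (bernoulli_cdf a).
Local Notation Finv := (bernoulli_cdf_inv a).
Hypothesis a_indep : mutually_independent a.
Hypothesis a_fair : forall i, fair_digit (a i).

Lemma bernoulli_cdf_surj (l : R) :
  l \in `]2^-1, 1[ -> set_surj `[0, 1] `[0, 1] (F l).
Proof.
move=> hl t /=; rewrite in_itv/= => t01.
have [||c c01 Fc] := @IVT R (F l) 0 1 t ler01; last by exists c.
  by apply: continuous_subspaceT => x; exact: bernoulli_cdf_continuous.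
by rewrite bernoulli_cdf0// bernoulli_cdf1// minElt maxElt ltr01.
Qed.

Lemma bernoulli_cdf_invK (l t : R) :
  l \in `]2^-1, 1[ -> 0 <= t <= 1 -> F l (Finv l t) = t.
Proof.
move=> hl t01; apply: (surjpK _ (bernoulli_cdf_surj l hl)).
by rewrite inE/= in_itv.
Qed.

Lemma bernoulli_cdf_inv_in01 (l t : R) : l \in `]2^-1, 1[ -> 0 <= t <= 1 ->
  0 <= Finv l t <= 1.
Proof.
move=> hl t01.
have : `[0, 1]%classic (Finv l t).
  apply: (surjpinv_image_sub (bernoulli_cdf_surj l hl)).
  by exists t => //=; rewrite in_itv.
by rewrite /= in_itv.
Qed.

(** Since each [F l] is monotone, [Finv l t < y] and [y < Finv l t] can be read
off the value of [F l] at the fixed point [y], which converges with [l];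
strict monotonicity of the limit [F l0] provides the room. *)
Lemma bernoulli_cdf_inv_cvg (l0 : R) (t : R -> R) : l0 \in `]2^-1, 1[ ->
  (forall l, l \in `]2^-1, 1[ -> 0 <= t l <= 1) ->
  t l @[l --> within `]2^-1, 1[ (nbhs l0)] --> t l0 ->
  Finv l (t l) @[l --> within `]2^-1, 1[ (nbhs l0)] --> Finv l0 (t l0).
Proof.
move=> hl0 t01 tcvg; apply/cvgrPdist_le => e e0.
set y := Finv l0 (t l0).
have /andP[y0 y1] : 0 <= y <= 1 by exact: bernoulli_cdf_inv_in01 (t01 _ hl0).
have Fy : F l0 y = t l0 by exact: bernoulli_cdf_invK (t01 _ hl0).
have near_ratio : \forall l \near within `]2^-1, 1[ (nbhs l0), l \in `]2^-1, 1[.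
  exact: withinT.
have lower : \forall l \near within `]2^-1, 1[ (nbhs l0), y - e <= Finv l (t l).
  have [ye|ye] := ltP (y - e) 0.
    near=> l; apply: ltW; apply: lt_le_trans ye _.
    have hl : l \in `]2^-1, 1[ by near: l.
    by have /andP[] := bernoulli_cdf_inv_in01 l (t l) hl (t01 _ hl).
  have Flt : F l0 (y - e) < t l0.
    by rewrite -Fy; apply: bernoulli_cdf_lt => //; lra.
  have : t l - F l (y - e) @[l --> within `]2^-1, 1[ (nbhs l0)] -->
      t l0 - F l0 (y - e) by apply: cvgB => //; exact: bernoulli_cdf_cvg_ratio.
  move=> /cvgr_gt/(_ 0); rewrite subr_gt0 => /(_ Flt) gap.
  near=> l; have hl : l \in `]2^-1, 1[ by near: l.
  rewrite leNgt; apply/negP => /ltW /(bernoulli_cdf_homo a l hl).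
  rewrite bernoulli_cdf_invK ?t01//; apply/negP; rewrite -ltNge -subr_gt0.
  by near: l.
have upper : \forall l \near within `]2^-1, 1[ (nbhs l0), Finv l (t l) <= y + e.
  have [ye|ye] := ltP 1 (y + e).
    near=> l; apply: ltW; apply: le_lt_trans ye.
    have hl : l \in `]2^-1, 1[ by near: l.
    by have /andP[] := bernoulli_cdf_inv_in01 l (t l) hl (t01 _ hl).
  have Flt : t l0 < F l0 (y + e).
    by rewrite -Fy; apply: bernoulli_cdf_lt => //; lra.
  have : F l (y + e) - t l @[l --> within `]2^-1, 1[ (nbhs l0)] -->
      F l0 (y + e) - t l0 by apply: cvgB => //; exact: bernoulli_cdf_cvg_ratio.
  move=> /cvgr_gt/(_ 0); rewrite subr_gt0 => /(_ Flt) gap.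
  near=> l; have hl : l \in `]2^-1, 1[ by near: l.
  rewrite leNgt; apply/negP => /ltW /(bernoulli_cdf_homo a l hl).
  rewrite bernoulli_cdf_invK ?t01//; apply/negP; rewrite -ltNge -subr_gt0.
  by near: l.
near=> l; rewrite ler_norml; apply/andP; split.
  suff : Finv l (t l) <= y + e by lra.
  by near: l.
suff : y - e <= Finv l (t l) by lra.
by near: l.
Unshelve. all: by end_near. Qed.

Lemma bernoulli_cdf_inv_double_cvg (l0 x : R) :
  l0 \in `]2^-1, 1[ -> x <= 2^-1 ->
  Finv l (2 * F l x) @[l --> within `]2^-1, 1[ (nbhs l0)] -->
  Finv l0 (2 * F l0 x).
Proof.
move=> hl0 x2; apply: (bernoulli_cdf_inv_cvg l0 (fun l => 2 * F l x)) => //.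
  move=> l hl; have := bernoulli_cdf_ge0 a l x.
  have := bernoulli_cdf_half a a_indep a_fair l hl.
  by have := bernoulli_cdf_homo a l hl _ _ x2; lra.
by apply: cvgM; [exact: cvg_cst|exact: bernoulli_cdf_cvg_ratio].
Qed.
End inverse.

Theorem theorem2p2 (R : realType) (d : measure_display)
    (Omega : measurableType d) (P : probability Omega R)
    (a : nat -> {RV P >-> bool}) (a_indep : mutually_independent a)
    (a_fair : forall i, fair_digit (a i))
    (x : R) (hx : x \in `[0, 1]) (l0 : R) (hl0 : l0 \in `]2^-1, 1[) :
  bernoulli_phi a l x @[l --> within `]2^-1, 1[ (nbhs l0)]
    --> bernoulli_phi a l0 x.
Proof.
rewrite /bernoulli_phi; case: leP => x2.
  exact: bernoulli_cdf_inv_double_cvg.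
by apply: bernoulli_cdf_inv_double_cvg => //; lra.
Qed.
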